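(* Let $D=\mathbb{Q}\mathbb{U}_1$ be the rational Urysohn sphere, $\mathbb{U}_1$ its completion (the Urysohn sphere), and let $\iota:\mathbb{U}_1\to[0,1]^D$ be given by $\iota(z)(x)=d(z,x)$. Let $$K(D)=\{f\in[0,1]^D:\ |f(x)-f(y)|\le d(x,y)\le f(x)+f(y)\ \text{for all }x,y\in D\},$$ and let $S'_D(\mathbb{U}_1)$ be the closed convex hull of $\iota(\mathbb{U}_1)$ in $[0,1]^D$ (product topology). Then $$S'_D(\mathbb{U}_1)=K(D).$$ More precisely, the closure of $\iota(\mathbb{U}_1)$ in $[0,1]^D$ equals $K(D)$, and therefore the closed convex hull of $\iota(\mathbb{U}_1)$ is $K(D)$.
   Context: The rational Urysohn sphere $\mathbb{Q}\mathbb{U}_1$ is the (unique up to isometry) countable metric space $(D,d)$ with rational distances, of diameter one, with the following extension property: for every finite $F\subset D$ and every map $p:F\to\mathbb{Q}\cap[0,1]$ with $|p(x)-p(y)|\le d(x,y)\le p(x)+p(y)$ for all $x,y\in F$, there is $z\in D$ with $d(z,x)=p(x)$ for all $x\in F$. The Urysohn sphere $\mathbb{U}_1$ is the completion of $\mathbb{Q}\mathbb{U}_1$, with $\mathbb{Q}\mathbb{U}_1\subset\mathbb{U}_1$. *)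

(* Defs.v *)
From HB Require Import structures.
From mathcomp Require Import all_boot all_order all_algebra.
From mathcomp Require Import all_classical all_reals all_analysis.

Set Implicit Arguments.
Unset Strict Implicit.
Unset Printing Implicit Defensive.

Import Order.TTheory GRing.Theory Num.Theory.
Import numFieldNormedType.Exports.

Local Open Scope classical_set_scope.
Local Open Scope ring_scope.

#[short(type="completeMetricType")]
HB.structure Definition CompleteMetric (K : numDomainType) :=
  {T of CompletePseudoMetric K T & Metric K T}.

(* The [sup] of an empty or unbounded set is 0, so [diameter T = 1] does assert
   that the distances are bounded with least upper bound 1. *)
Definition diameter (R : realType) (T : metricType R) : R :=
  sup [set mdist xy.1 xy.2 | xy in [set: T * T]].

(* In the extension property only the values of [p] on [F] matter: this is a
   quantification over the maps from [F] to the rationals of [0, 1]. *)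
Record rational_urysohn_sphere (R : realType) (D : metricType R) : Prop := {
  rus_countable : countable [set: D] ;
  rus_rational : forall x y : D, exists q : rat, mdist x y = ratr q ;
  rus_diameter : diameter D = 1 ;
  rus_extension : forall (F : set D) (p : D -> rat),
    finite_set F ->
    (forall x, F x -> 0 <= p x <= 1) ->
    (forall x y, F x -> F y ->
      `|ratr (p x) - ratr (p y)| <= mdist x y <= ratr (p x) + ratr (p y)) ->
    exists z : D, forall x, F x -> mdist z x = ratr (p x)
}.

(* [U] is complete by its type. *)
Definition is_completion (R : realType) (D : metricType R)
    (U : completeMetricType R) (j : D -> U) : Prop :=
  (forall x y : D, mdist (j x) (j y) = mdist x y) /\ dense (range j).

Definition cube (R : realType) (D : metricType R) : set {ptws D -> R} :=
  [set f | forall x, 0 <= f x <= 1].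
Arguments cube {R} D _.

Definition katetov (R : realType) (D : metricType R) : set {ptws D -> R} :=
  [set f | cube D f /\
    forall x y : D, `|f x - f y| <= mdist x y <= f x + f y].
Arguments katetov {R} D _.

(* The map iota of the Urysohn sphere into [0, 1]^D. *)
Definition dist_map (R : realType) (D : metricType R)
    (U : completeMetricType R) (j : D -> U) (z : U) : {ptws D -> R} :=
  fun x => mdist z (j x).

(* Closures and closed sets are taken in [0, 1]^D, that is, for the topology
   that the product topology of R^D induces on [cube D]. The library isolates
   the points outside [cube D] in [subspace (cube D)], so they are never added
   to the closure of a subset of [cube D]. *)
Definition cube_closure (R : realType) (D : metricType R)
    (A : set {ptws D -> R}) : set {ptws D -> R} :=
  closure (A : set (subspace (cube D))).

Definition closed_convex_hull (R : realType) (D : metricType R)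
    (A : set {ptws D -> R}) : set {ptws D -> R} :=
  smallest [set C : set {ptws D -> R} |
    [/\ C `<=` cube D, closed (C : set (subspace (cube D)))
      & convex_set (C : set (convex_lmodType (D -> R^o)))]] A.

(* Main.v *)
(** Rounding a Katetov function [f] up to the grid [N^-1 Z], where [N] is a
    common denominator of the distances between points of a finite set [F],
    preserves on [F] all the inequalities defining [katetov D], because both
    [d x y] and 1 lie on the grid. The extension property realizes the rounded
    function by a point of [D], so that [f] is a pointwise limit of distance
    functions. Conversely [katetov D] is closed and convex and contains the
    distance functions, so it is both their closure and their closed convex
    hull. *)
Require Import Defs.
From mathcomp Require Import all_boot all_order all_algebra.
From mathcomp Require Import all_classical all_reals all_analysis.
From mathcomp Require Import lra.
Local Open Scope classical_set_scope.

Set Implicit Arguments.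
Unset Strict Implicit.
Unset Printing Implicit Defensive.

Import Order.TTheory GRing.Theory Num.Theory.
Import numFieldNormedType.Exports.

Local Open Scope ring_scope.

Lemma common_denominator (s : seq rat) :
  exists2 N : nat, (0 < N)%N &
    forall q, q \in s -> exists k : int, N%:R * q = k%:~R.
Proof.
elim: s => [|q s [N N0 Ns]]; first by exists 1%N.
exists (`|denq q| * N)%N; first by rewrite muln_gt0 N0 absz_gt0 denq_neq0.
move=> r; rewrite inE => /orP[/eqP->|/Ns[k kE]].
  exists (N%:Z * numq q); rewrite natrM intrM mulrAC.
  by rewrite pmulrn absz_denq mulrC [_ * q]mulrC numqE.
by exists (denq q * k); rewrite natrM -mulrA kE intrM pmulrn absz_denq.
Qed.

Section rational_urysohn_sphere_theory.
Context (R : realType) (D : metricType R).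
Hypothesis hD : rational_urysohn_sphere D.

Lemma rus_mdist_le1 (x y : D) : mdist x y <= 1.
Proof.
rewrite -(rus_diameter hD); apply: ub_le_sup; last by exists (x, y).
(* Without a supremum the set would have [sup] 0 by convention, contradicting diameter 1; so the
   distances are bounded. *)
have [[]//|nsup] := pselect (has_sup [set mdist xy.1 xy.2 | xy in [set: D * D]]).
have := rus_diameter hD; rewrite /diameter sup_out// => /eqP.
by rewrite eq_sym oner_eq0.
Qed.

Lemma katetov_approx (f : {ptws D -> R}) (F : set D) (m : nat) :
  katetov D f -> finite_set F ->
  exists z, forall x, F x -> f x <= mdist z x <= f x + m.+1%:R^-1.
Proof.
move=> [f01 fK] finF.
have /choice[q qE] (xy : D * D) := rus_rational hD xy.1 xy.2.
have /finite_seqP[s sE] := finF.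
have [N N0 Nint] := common_denominator [seq q (x, y) | x <- s, y <- s].
(* The factor [m.+1] makes the grid fine enough for the required precision; distances between points
   of [F] stay on the finer grid. *)
pose M := (N * m.+1)%N.
have M0 : 0 < M%:R :> R by rewrite ltr0n muln_gt0 N0.
pose p x : rat := (Num.ceil (M%:R * f x))%:~R / M%:R.
have pE x : ratr (p x) = (Num.ceil (M%:R * f x))%:~R / M%:R :> R.
  by rewrite /p fmorph_div/= ratr_int ratr_nat.
have Md x y : F x -> F y -> exists k : int, M%:R * mdist x y = k%:~R.
  rewrite sE/= => xs ys.
  have [|k kE] := Nint (q (x, y)); first exact: allpairs_f.
  exists (m.+1%:Z * k); rewrite (qE (x, y)) /M mulnC natrM -mulrA.
  rewrite intrM; congr (_ * _); apply/esym.
  by rewrite -(ratr_int R k) -kE rmorphM/= ratr_nat.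
have p_ge x : f x <= ratr (p x).
  by rewrite pE ler_pdivlMr// mulrC ceil_ge.
have p_lip x y : F x -> F y -> ratr (p x) <= ratr (p y) + mdist x y :> R.
  move=> Fx Fy; have [k kE] := Md x y Fx Fy.
  have -> : mdist x y = k%:~R / M%:R by rewrite -kE mulrAC mulfV ?mul1r ?gt_eqF.
  rewrite !pE -mulrDl ler_pM2r ?invr_gt0// -intrD ler_int ceil_le_int intrD -kE.
  have := fK x y => /andP[]; rewrite ler_norml => /andP[_ fxy] _.
  apply: (@le_trans _ _ (M%:R * f y + M%:R * mdist x y)).
    by rewrite -mulrDr ler_pM2l// -lerBlDl.
  by rewrite lerD2r ceil_ge.
have [z zE] : exists z, forall x, F x -> mdist z x = ratr (p x).
  apply: (rus_extension hD) => // [x Fx|x y Fx Fy].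
    rewrite -(ler_rat R 0) -(ler_rat R _ 1) rmorph0 rmorph1.
    have /andP[f0 f1] := f01 x.
    rewrite (le_trans f0)//= pE ler_pdivrMr// mul1r.
    rewrite -[leRHS]/(M%:Z%:~R) ler_int ceil_le_int.
    by rewrite -[leRHS]mulr1 ler_pM2l.
  apply/andP; split.
    have := p_lip x y Fx Fy; have := p_lip y x Fy Fx.
    by rewrite (metric_sym y x) ler_norml; lra.
  (* Rounding up only increases the sum. *)
  by have /andP[_ /le_trans] := fK x y; apply; rewrite lerD.
exists z => x Fx; rewrite zE// p_ge/= pE ler_pdivrMr// mulrDl.
have -> : m.+1%:R^-1 * M%:R = N%:R :> R by rewrite natrM mulrCA mulVf ?mulr1.
have := ceilB1_lt (M%:R * f x); rewrite intrB ltrBlDr mulrC => /ltW/le_trans.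
by apply; rewrite lerD2l ler1n.
Qed.

End rational_urysohn_sphere_theory.

Section katetov_theory.
Context (R : realType) (D : metricType R).

Lemma closed_katetov : closed (katetov D).
Proof.
pose ev (x : D) (f : {ptws D -> R}) : R := f x.
have evc x : continuous (ev x) by exact: proj_continuous.
(* Each condition becomes the preimage of a closed half-line under a continuous combination of
   evaluations. The absolute value is replaced by one-sided bounds over all ordered pairs. *)
have -> : katetov D =
    \bigcap_x (ev x @^-1` [set r | 0 <= r]) `&`
    \bigcap_x (ev x @^-1` [set r | r <= 1]) `&`
    \bigcap_xy ((ev xy.1 \- ev xy.2) @^-1` [set r | r <= mdist xy.1 xy.2]) `&`
    \bigcap_xy ((ev xy.1 \+ ev xy.2) @^-1` [set r | mdist xy.1 xy.2 <= r]).
  apply/seteqP; split => [f [f01 fK]|f [[[f0 f1] fB] fD]].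
    split; [split; [split|]|] => [x _|x _|[x y] _|[x y] _] /=.
    - by have /andP[] := f01 x.
    - by have /andP[] := f01 x.
    - by have /andP[/ler_normlP[_ +] _] := fK x y.
    - by have /andP[] := fK x y.
  split=> [x|x y]; first by apply/andP; split; [exact: f0|exact: f1].
  apply/andP; split; last exact: (fD (x, y)).
  have := fB (x, y) I; have := fB (y, x) I => /=.
  by rewrite /ev (metric_sym y x) ler_norml; lra.
apply: closedI; [apply: closedI; [apply: closedI|]|];
  apply: closed_bigI => i _; apply: closed_comp => [f _|].
- exact: evc.
- exact: closed_ge.
- exact: evc.
- exact: closed_le.
- exact: (@cvgB R R^o _ _ _ _ _ _ _ (evc i.1 f) (evc i.2 f)).
- exact: closed_le.
- exact: (@cvgD R R^o _ _ _ _ _ _ _ (evc i.1 f) (evc i.2 f)).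
- exact: closed_ge.
Qed.

Lemma convex_katetov :
  convex_set (katetov D : set (convex_lmodType (D -> R^o))).
Proof.
move=> f g t /set_mem[f01 fK] /set_mem[g01 gK]; apply/mem_set.
have tE x : conv t (f : convex_lmodType (D -> R^o)) g x =
    t%:num * f x + (1 - t%:num) * g x by [].
have t0 : 0 <= t%:num by [].
have t1 : 0 <= 1 - t%:num by rewrite subr_ge0.
split=> [x|x y]; rewrite /= !tE.
  by have /andP[? ?] := f01 x; have /andP[? ?] := g01 x; nra.
have /andP[] := fK x y; have /andP[] := gK x y.
by rewrite !ler_norml; nra.
Qed.

End katetov_theory.

Section dist_map_theory.
Context (R : realType) (D : metricType R) (U : completeMetricType R) (j : D -> U).
Hypotheses (hD : rational_urysohn_sphere D) (hU : is_completion j).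

Lemma completion_approx (z : U) (e : R) : 0 < e -> exists w, mdist z (j w) < e.
Proof.
(* Density speaks of open sets, hence the interior of the ball. *)
move=> e0; have [_ /(_ (ball z e)^° )] := hU.
case; [|exact: open_interior|].
  by exists z; apply: nbhsx_ballx.
move=> _ [/interior_subset/[swap] [[w _ <-]]]; rewrite ballEmdist.
by exists w.
Qed.

Lemma dist_map_katetov (z : U) : katetov D (dist_map j z).
Proof.
have [jd _] := hU; split=> [x|x y]; rewrite /dist_map.
  (* The bound 1 is known only between points of [D]; it passes to [z] through a point [j w] within
     [e] of [z]. *)
  rewrite mdist_ge0/=; apply/ler_addgt0Pl => e /(completion_approx z)[w zw].
  rewrite (le_trans (metric_triangle _ (j w) _))// lerD ?(ltW zw)// jd.
  exact: rus_mdist_le1 hD _ _.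
have := metric_triangle z (j x) (j y); have := metric_triangle z (j y) (j x).
have := metric_triangle (j x) z (j y).
by rewrite (metric_sym (j y)) (metric_sym (j x) z) jd ler_norml; lra.
Qed.

(** Countability of [D] makes a sequence suffice: the finite sets of points with code below [n]
    exhaust [D], and the [n]-th term approximates [f] on the [n]-th set with error at most
    [n.+1%:R^-1]. *)
Lemma katetov_subset_closure :
  katetov D `<=` closure (range (dist_map j)).
Proof.
move=> f fK; have [jd _] := hU.
have /countable_injP[c cinj] := rus_countable hD.
have fin n : finite_set [set x | (c x < n)%N].
  by apply: (@finite_preimage _ _ `I_n c) => // x y _ _; apply: cinj; exact: mem_set.
have /choice[z zf] n := katetov_approx hD n fK (fin n).
have zcvg : {ptws, (fun n => dist_map j (j (z n))) @ \oo --> f}.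
  apply/pointwise_cvgP => x.
  apply: (@squeeze_cvgr _ _ _ _ (cst (f x)) (fun n => f x + n.+1%:R^-1)).
  - near=> n; rewrite /dist_map jd; apply: zf => /=; near: n.
    by exists (c x).+1.
  - exact: cvg_cst.
  - rewrite -[X in _ --> X]addr0; apply: cvgD; first exact: cvg_cst.
    exact: cvg_harmonic.
move=> B /zcvg[n _ nB]; exists (dist_map j (j (z n))).
by split; [exists (j (z n))|exact: nB (leqnn n)].
Unshelve. all: by end_near.
Qed.

End dist_map_theory.

Theorem proposition5p2 (R : realType) (D : metricType R)
    (U : completeMetricType R) (j : D -> U)
    (hD : rational_urysohn_sphere D) (hU : is_completion j) :
  cube_closure (range (dist_map j)) = katetov D /\
  closed_convex_hull (range (dist_map j)) = katetov D.
Proof.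
have rK : range (dist_map j) `<=` katetov D.
  by move=> _ [z _ <-]; exact: dist_map_katetov.
have Kcube : katetov D `<=` cube D by move=> f [].
have clE : cube_closure (range (dist_map j)) = katetov D.
  (* For a subset of the cube, the closure in the cube is the trace of the closure in the full
     product. *)
  rewrite /cube_closure closure_subspaceW; last exact: subset_trans Kcube.
  apply/seteqP; split=> [f [clf _]|f fK]; last first.
    by split; [exact: katetov_subset_closure|exact: Kcube].
  by apply: closed_katetov; exact: closureS clf.
split=> //; apply/seteqP; split.
  apply: smallest_sub => //; split=> //.
  - by apply: closed_subspaceW; exact: closed_katetov.
  - exact: convex_katetov.
(* Every competitor [C] is closed in the cube and contains the range, hence also its closure, which
   is [katetov D]. *)
rewrite -clE => f clf C [[_ clC _] rC].
by apply: clC; exact: closureS clf.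
Qed.
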